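(* Let $\mathbf{K}$ be a field of characteristic $0$. Any identity satisfied by the commutator product in every bicommutative algebra over $\mathbf{K}$ is a consequence of the three identities $$[a,b]=-[b,a],$$ $$[[a,b],c]+[[b,c],a]+[[c,a],b]=0,$$ $$[[a,b],[c,d]]=0$$ (anti-commutativity, the Jacobi identity and the metabelian identity). That is, if a nonassociative polynomial $f$ in one binary operation vanishes identically on $A^{(-)}$ for every bicommutative algebra $A$ over $\mathbf{K}$, then $f$ vanishes identically on every $\mathbf{K}$-algebra whose product $[\cdot,\cdot]$ satisfies the three identities above.
   Context: All algebras are (not necessarily associative, not necessarily unital) algebras over $\mathbf{K}$. An algebra is called bicommutative if it satisfies the identities $a(bc)=b(ac)$ and $(ab)c=(ac)b$. For an algebra $A$, the commutator algebra $A^{(-)}$ is the vector space $A$ with the product $[x,y]=xy-yx$. An identity is an equation $f=0$ with $f$ an element of the free nonassociative algebra over $\mathbf{K}$ on countably many variables; it is satisfied by an algebra if $f$ evaluates to $0$ under every substitution of elements of the algebra. *)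

(* Defs.v *)
From HB Require Import structures.
From mathcomp Require Import all_boot all_algebra.
From mathcomp Require Import finmap.
From mathcomp Require Import monalg.

Set Implicit Arguments.
Unset Strict Implicit.
Unset Printing Implicit Defensive.

Import GRing.Theory.
Local Open Scope ring_scope.

(* The free magma on the variables Var 0, Var 1, ...; its elements are the
   nonassociative monomials (there is no empty word, so no constant term). *)
Inductive magma_word : Type :=
| Var of nat
| Mul of magma_word & magma_word.

Fixpoint tree_of_word (w : magma_word) : GenTree.tree nat :=
  match w with
  | Var i => GenTree.Leaf i
  | Mul u v => GenTree.Node 0 [:: tree_of_word u; tree_of_word v]
  end.

Fixpoint word_of_tree (t : GenTree.tree nat) : magma_word :=
  match t with
  | GenTree.Leaf i => Var i
  | GenTree.Node _ [:: u; v] => Mul (word_of_tree u) (word_of_tree v)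
  | GenTree.Node _ _ => Var 0
  end.

Lemma tree_of_wordK : cancel tree_of_word word_of_tree.
Proof. by elim=> //= u -> v ->. Qed.

HB.instance Definition _ := Countable.copy magma_word (can_type tree_of_wordK).

(* The free nonassociative algebra on countably many variables is the free
   K-module on the free magma; it is only needed here as a space of formal
   linear combinations, so its product is not introduced. *)
Definition napoly (K : fieldType) := {malg K[magma_word]}.

Fixpoint eval_word (A : Type) (op : A -> A -> A) (x : nat -> A)
    (w : magma_word) : A :=
  match w with
  | Var i => x i
  | Mul u v => op (eval_word op x u) (eval_word op x v)
  end.

Definition eval_napoly (K : fieldType) (A : lmodType K) (op : A -> A -> A)
    (x : nat -> A) (f : napoly K) : A :=
  \sum_(w <- msupp f) f@_w *: eval_word op x w.

Definition satisfies_identity (K : fieldType) (A : lmodType K)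
    (op : A -> A -> A) (f : napoly K) : Prop :=
  forall x : nat -> A, eval_napoly op x f = 0.

Definition bicommutative (A : Type) (op : A -> A -> A) : Prop :=
  (forall a b c, op a (op b c) = op b (op a c)) /\
  (forall a b c, op (op a b) c = op (op a c) b).

Definition commutator (A : zmodType) (op : A -> A -> A) : A -> A -> A :=
  fun x y => op x y - op y x.

Definition anticommutative (A : zmodType) (br : A -> A -> A) : Prop :=
  forall a b, br a b = - br b a.

Definition jacobi (A : zmodType) (br : A -> A -> A) : Prop :=
  forall a b c, br (br a b) c + br (br b c) a + br (br c a) b = 0.

Definition metabelian (A : zmodType) (br : A -> A -> A) : Prop :=
  forall a b c d, br (br a b) (br c d) = 0.

(* Main.v *)
Require Import Defs.
From HB Require Import structures.
From mathcomp Require Import all_boot all_algebra.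
From mathcomp Require Import finmap monalg.

Set Implicit Arguments.
Unset Strict Implicit.
Unset Printing Implicit Defensive.

Import GRing.Theory.
Local Open Scope ring_scope.

(** Let [A] be the free algebra on [e_0, e_1, ...] subject to [a(bc) = 0] and
    [(ab)c = (ac)b]; it is bicommutative, and has a basis of elements
    [(i, m) = e_i e_j1 ... e_jn] (left-normed) with [m = {j1, ..., jn}] a
    multiset.  Given a metabelian Lie algebra [L] and [x : nat -> L], the
    linear map [Phi : A -> L] sending [e_i] to [x_i] and [(i, m)] to
    [1/(n+1) sum_(j in m) [x_i, x_j, m - j]] commutes with the evaluation of
    commutator words: in both algebras a word of length at least 2 reduces to
    [0] or to a signed left-normed commutator, which in [A] is
    [(a, b + m) - (b, a + m)], and [Phi] of this is [[x_a, x_b, m]] by the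
    Jacobi identity, applied once for each element of [m].  Hence whatever
    vanishes on [A^(-)] vanishes on [L]. *)

(** * Linear maps and induction on a free module *)

Section LinearExtension.
Context {K : nzRingType} {T : choiceType} {V : lmodType K}.
Implicit Types (h : T -> V) (u v : {malg K[T]}).

Definition malg_lift h u : V := \sum_(k <- msupp u) u@_k *: h k.

Lemma malg_liftEw h (d : {fset T}) u : (msupp u `<=` d)%fset ->
  malg_lift h u = \sum_(k <- d) u@_k *: h k.
Proof.
move=> le; rewrite [LHS](big_fset_incl _ le) => //= k _ /mcoeff_outdom ->.
by rewrite scale0r.
Qed.

Lemma malg_lift_is_linear h : linear (malg_lift h).
Proof.
move=> c u v; pose d := (msupp u `|` (msupp v `|` msupp (c *: u + v)))%fset.
have ud : (msupp u `<=` d)%fset by rewrite fsubsetUl.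
have vd : (msupp v `<=` d)%fset by rewrite fsubsetU // fsubsetUl orbT.
have wd : (msupp (c *: u + v) `<=` d)%fset by rewrite !fsubsetU ?fsubset_refl ?orbT.
rewrite (malg_liftEw h ud) (malg_liftEw h vd) (malg_liftEw h wd).
rewrite scaler_sumr -big_split; apply: eq_bigr => k _.
by rewrite mcoeffD mcoeffZ scalerDl scalerA.
Qed.

HB.instance Definition _ h := GRing.isLinear.Build K {malg K[T]} V *:%R
  (malg_lift h) (malg_lift_is_linear h).

Lemma malg_liftU h k : malg_lift h << k >> = h k.
Proof.
by rewrite (malg_liftEw h msuppU_le) big_seq_fset1 mcoeffUU scale1r.
Qed.

Lemma malg_ind (P : {malg K[T]} -> Prop) :
  P 0 -> (forall c k u, P u -> P (c *: << k >> + u)) -> forall u, P u.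
Proof.
move=> P0 PD u; rewrite (monalgE u).
elim: (enum_fset (msupp u)) => [|k s IH]; rewrite ?big_nil // big_cons.
have -> : << u@_k *g k >> = u@_k *: << k >>; last exact: PD.
by apply/malgP => l; rewrite mcoeffZ !mcoeffU mulrnAr mulr1.
Qed.

End LinearExtension.

(** Both identities are trilinear, so a spanning family suffices; the induction principle in the
    first premise expresses that [e] spans. *)
Lemma bicommutative_basis (K : fieldType) (V : lmodType K)
    (mul : {bilinear V -> V -> V}) (I : Type) (e : I -> V) :
  (forall P : V -> Prop,
     P 0 -> (forall c k u, P u -> P (c *: e k + u)) -> forall u, P u) ->
  (forall k l m, mul (e k) (mul (e l) (e m)) = mul (e l) (mul (e k) (e m))) ->
  (forall k l m, mul (mul (e k) (e l)) (e m) = mul (mul (e k) (e m)) (e l)) ->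
  bicommutative mul.
Proof.
move=> e_ind mulCA mulAC; split=> a b c.
- elim/e_ind: a => [|x k a IH]; first by rewrite !linear0l linear0r.
  rewrite !linearPl linearPr /= IH; congr (_ *: _ + _) => {a IH}.
  elim/e_ind: b => [|x' l b IH]; first by rewrite !linear0l linear0r.
  rewrite !linearPl linearPr /= IH; congr (_ *: _ + _) => {b IH}.
  elim/e_ind: c => [|x'' m c IH]; first by rewrite !linear0r.
  by rewrite !linearPr /= IH mulCA.
- elim/e_ind: a => [|x k a IH]; first by rewrite !linear0l.
  rewrite !linearPl /= IH; congr (_ *: _ + _) => {a IH}.
  elim/e_ind: b => [|x' l b IH]; first by rewrite !(linear0r, linear0l).
  rewrite !linearPr linearPl /= IH; congr (_ *: _ + _) => {b IH}.
  elim/e_ind: c => [|x'' m c IH]; first by rewrite !(linear0r, linear0l).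
  by rewrite !linearPr linearPl /= IH mulAC.
Qed.

(** * A bicommutative algebra on words *)

Section WordAlgebra.
Variable K : fieldType.

(* Sorted sequences encode multisets, so that equality is Leibniz. *)
Definition walg := {malg K[(nat * seq nat)%type]}.
HB.instance Definition _ := GRing.Lmodule.on walg.

Definition wbasis i (s : seq nat) : walg := << (i, sort leq s) >>.

Lemma wbasis_perm i s t : perm_eq s t -> wbasis i s = wbasis i t.
Proof.
move=> st; congr << (i, _) >>.
by apply/perm_sortP => //; [exact: leq_total | exact: leq_trans | exact: anti_leq].
Qed.

Definition wmul_basis (k l : nat * seq nat) : walg :=
  if l.2 is [::] then wbasis k.1 (l.1 :: k.2) else 0.

Definition wmul (u v : walg) : walg :=
  malg_lift (fun k => malg_lift (wmul_basis k) v) u.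

Lemma wmulPl w c u v : wmul (c *: u + v) w = c *: wmul u w + wmul v w.
Proof. exact: linearP. Qed.

Lemma wmulPr w c u v : wmul w (c *: u + v) = c *: wmul w u + wmul w v.
Proof.
rewrite /wmul /malg_lift scaler_sumr -big_split.
apply: eq_bigr => k _; rewrite -!/(malg_lift _ _).
by rewrite linearP scalerDr !scalerA mulrC.
Qed.

HB.instance Definition _ := isBilinear.Build K walg walg walg *:%R *:%R wmul
  (fun v => zmod_morphism_linear (wmulPl v))
  (fun u => zmod_morphism_linear (wmulPr u))
  (fun v => scalable_linear (wmulPl v))
  (fun u => scalable_linear (wmulPr u)).

Lemma wmulUU k l : wmul << k >> << l >> = wmul_basis k l.
Proof. by rewrite /wmul !malg_liftU. Qed.

Lemma wmulU_wbasis k j t :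
  wmul << k >> (wbasis j t) = if t is [::] then wbasis k.1 (j :: k.2) else 0.
Proof.
rewrite /wbasis wmulUU /wmul_basis /=.
by case: t => //= i t; case E: (sort _ _) (size_sort leq (i :: t)).
Qed.

Lemma wmul_wbasis i s j t :
  wmul (wbasis i s) (wbasis j t) = if t is [::] then wbasis i (j :: s) else 0.
Proof.
rewrite {1}/wbasis wmulU_wbasis /=; case: t => //.
by apply: wbasis_perm; rewrite perm_cons perm_sort.
Qed.

(** Any product is 0 or a word of length at least 2, hence is killed as a right factor: both sides
    of the first identity are 0. Basis pairs with an unsorted sequence are covered too, since
    products are sorted anew. *)
Lemma wmul_bicommutative : bicommutative wmul.
Proof.
apply: (@bicommutative_basis K walg wmul _ (fun k => << k >>)) => [|k l m|k l m].
- exact: malg_ind.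
- rewrite /= !wmulUU /wmul_basis; case: m.2 => [|? ?]; last by rewrite !linear0r.
  by rewrite !wmulU_wbasis.
- rewrite /= !wmulUU /wmul_basis.
  (* Both sides vanish unless [l] and [m] are generators; then each adds the same two letters to the
     multiset of [k]. *)
  case El: l.2 => [|? ?]; case Em: m.2 => [|? ?].
  + rewrite /wbasis !wmulUU /wmul_basis El Em; apply: wbasis_perm => /=.
    have h a b s : perm_eq (a :: sort leq (b :: s)) (a :: b :: s).
      by rewrite perm_cons perm_sort.
    rewrite (permPl (h _ _ _)) (permPr (h _ _ _)).
    exact/permPl/(perm_catCA [:: _] [:: _]).
  + by rewrite linear0l; rewrite /wbasis wmulUU; rewrite /wmul_basis Em.
  + by rewrite linear0l; rewrite /wbasis wmulUU; rewrite /wmul_basis El.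
  + by rewrite !linear0l.
Qed.

End WordAlgebra.

(** * Left-normed commutators in a metabelian Lie algebra *)

Section MetabelianLie.
Variables (K : fieldType) (charK0 : [pchar K] =i pred0).
Variables (L : lmodType K) (br : {bilinear L -> L -> L}).
Hypotheses (brC : anticommutative br) (brJ : jacobi br) (brM : metabelian br).
Variable x : nat -> L.

Lemma natr_neq0 n : (n.+1%:R : K) != 0.
Proof. by move/pcharf0P: charK0 => ->. Qed.

(** The Jacobi identity in derivation form. When [u] is itself a commutator, the right side is 0 by
    the metabelian identity, so the letters after a commutator may be permuted. *)
Lemma br_swap u v w : br (br u v) w - br (br u w) v = br u (br v w).
Proof.
have /eqP := brJ u v w; rewrite [br (br v w) u]brC (brC w u) linearNl /=.
by rewrite addrAC subr_eq0 => /eqP.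
Qed.

Definition lnorm (u : L) (s : seq nat) : L := foldl (fun u j => br u (x j)) u s.

Lemma lnormB u v s : lnorm (u - v) s = lnorm u s - lnorm v s.
Proof. by elim: s u v => //= j s IH u v; rewrite linearBl IH. Qed.

Lemma lnormN u s : lnorm (- u) s = - lnorm u s.
Proof. by elim: s u => //= j s IH u; rewrite linearNl IH. Qed.

Lemma lnorm_br u v s : exists u' v', lnorm (br u v) s = br u' v'.
Proof. by elim: s u v => /= [|j s IH] u v; [exists u, v | exact: IH]. Qed.

Lemma lnorm_rem u v j s :
  j \in s -> lnorm (br u v) (j :: rem j s) = lnorm (br u v) s.
Proof.
elim: s u v => //= k s IH u v; rewrite inE eq_sym.
case: eqP => [->//|_] /= /(IH (br u v)) <- /=; congr lnorm.
by apply/eqP; rewrite -subr_eq0 br_swap brM.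
Qed.

Lemma lnorm_perm u v s t :
  perm_eq s t -> lnorm (br u v) s = lnorm (br u v) t.
Proof.
elim: s t u v => [|j s IH] t u v st.
  by move: st; rewrite perm_sym => /perm_nilP ->.
have jt : j \in t by rewrite -(perm_mem st) mem_head.
rewrite -(lnorm_rem _ _ jt) /=; apply: IH.
by rewrite -(perm_cons j) (perm_trans st) // perm_to_rem.
Qed.

Definition lcomm a b s : L := lnorm (br (x a) (x b)) s.

(* The factor [1/(n+1)] rather than [1/n]: each of the [n-1] Jacobi identities
   contributes one more copy of the commutator to the two direct terms. *)
Definition Phi_basis (k : nat * seq nat) : L :=
  if k.2 is [::] then x k.1 else
  (size k.2).+1%:R^-1 *: \sum_(j <- k.2) lcomm k.1 j (rem j k.2).

Lemma Phi_basis_cons i j s : Phi_basis (i, j :: s) =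
  (size s).+2%:R^-1 *: \sum_(k <- j :: s) lcomm i k (rem k (j :: s)).
Proof. by []. Qed.

Lemma Phi_basis_perm i s t : perm_eq s t -> Phi_basis (i, s) = Phi_basis (i, t).
Proof.
move=> st; rewrite /Phi_basis /= (perm_size st).
case: s t st => [|j s] [|k t] st //; try by have := perm_size st.
rewrite (perm_big _ st) /=; congr (_ *: _); apply: eq_big_seq => l l_kt.
have l_js : l \in j :: s by rewrite (perm_mem st).
apply: lnorm_perm; rewrite -(perm_cons l).
by rewrite -(permPl (perm_to_rem l_js)) -(permPr (perm_to_rem l_kt)).
Qed.

(** After the other letters are permuted to the end, this is the Jacobi identity for [x a], [x b],
    [x j]. *)
Lemma lcommB a b j s : j \in s ->
  lcomm a j (rem j (b :: s)) - lcomm b j (rem j (a :: s)) = lcomm a b s.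
Proof.
move=> js.
have rem_lcomm c d : lcomm c j (rem j (d :: s)) =
    lnorm (br (br (x c) (x j)) (x d)) (rem j s).
  apply: (@lnorm_perm _ _ _ (d :: rem j s)).
  have jds : j \in d :: s by rewrite inE js orbT.
  rewrite -(perm_cons j) perm_sym -(permPr (perm_to_rem jds)).
  by rewrite (perm_catCA [:: j] [:: d]) /= perm_cons perm_sym perm_to_rem.
rewrite !rem_lcomm -lnormB /lcomm -(lnorm_rem _ _ js) /=; congr lnorm.
rewrite (brC (x b) (x j)) linearNl /= opprK.
by rewrite [br (br (x j) _) _]brC -br_swap opprB addrC subrK.
Qed.

Lemma lcommC a b s : lcomm b a s = - lcomm a b s.
Proof. by rewrite /lcomm brC lnormN. Qed.

(** * The linear map commutes with evaluation of commutator words *)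

Section Intertwining.
(* The hypotheses hold for [walg], on which unification unfolds too far. *)
Variables (A : lmodType K) (mul : {bilinear A -> A -> A}).
Variable e : nat -> seq nat -> A.
Hypothesis e_perm : forall i s t, perm_eq s t -> e i s = e i t.
Hypothesis mul_e : forall i s j t,
  mul (e i s) (e j t) = if t is [::] then e i (j :: s) else 0.
Variable Phi : {linear A -> L}.
Hypothesis Phi_e : forall i s, Phi (e i s) = Phi_basis (i, s).

Definition ecomm a b s : A := e a (b :: s) - e b (a :: s).

Lemma commutatorZl c u v : commutator mul (c *: u) v = c *: commutator mul u v.
Proof. by rewrite /commutator linearZl_LR linearZr_LR scalerBr. Qed.

Lemma commutatorC u v : commutator mul u v = - commutator mul v u.
Proof. by rewrite /commutator opprB. Qed.

(** Only right multiplication by the generator contributes, because [ecomm a b s] is killed as a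
    right factor. *)
Lemma commutator_ecomm a b s i :
  commutator mul (ecomm a b s) (e i [::]) = ecomm a b (rcons s i).
Proof.
rewrite /commutator /ecomm linearBl linearBr /= !mul_e subrr subr0.
by congr (_ - _); apply: e_perm; rewrite -rcons_cons perm_sym perm_rcons.
Qed.

Lemma commutator_ecomm2 a b s c d t :
  commutator mul (ecomm a b s) (ecomm c d t) = 0.
Proof.
by rewrite /commutator /ecomm !linearBl !linearBr /= !mul_e !subrr.
Qed.

Lemma Phi_ecomm a b s : Phi (ecomm a b s) = lcomm a b s.
Proof.
rewrite /ecomm linearB /= !Phi_e !Phi_basis_cons -scalerBr.
have -> : \sum_(k <- b :: s) lcomm a k (rem k (b :: s)) -
    \sum_(k <- a :: s) lcomm b k (rem k (a :: s)) = (size s).+2%:R *: lcomm a b s.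
  (* The terms [k = b] and [k = a] give two copies of [lcomm a b s]; each letter of [s] gives one
     more by [lcommB]. *)
  rewrite !big_cons [in X in X + _ - _]/= [in X in _ - (X + _)]/= !eqxx.
  rewrite opprD addrACA -sumrB (eq_big_seq _ (fun j js => lcommB a b js)).
  rewrite big_const_seq count_predT iter_addr_0 (lcommC a b) opprK -mulr2n.
  by rewrite -mulrnDr scaler_nat.
by rewrite scalerA mulVf ?scale1r ?natr_neq0.
Qed.

(** The same [c], [a], [b], [s] serve both algebras, which makes the two evaluations comparable
    under [Phi]. *)
Lemma eval_word_commutator w :
  (exists i, w = Var i) \/
  exists c a b s,
    eval_word (commutator mul) (e^~ [::]) w = c *: ecomm a b s /\
    eval_word br x w = c *: lcomm a b s.
Proof.
elim: w => [i|u IHu v IHv]; first by left; exists i.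
right; case: IHu => [[i ->]|[c [a [b [s [/= -> ->]]]]]];
  case: IHv => [[j ->]|[d [a' [b' [t [/= -> ->]]]]]] /=.
- exists 1, i, j, [::]; rewrite !scale1r; split=> //.
  by rewrite /commutator !mul_e.
- exists (- d), a', b', (rcons t i); split.
    by rewrite commutatorC commutatorZl commutator_ecomm scaleNr.
  by rewrite brC linearZl_LR /= /lcomm /lnorm -cats1 foldl_cat /= scaleNr.
- exists c, a, b, (rcons s j); split.
    by rewrite commutatorZl commutator_ecomm.
  by rewrite linearZl_LR /= /lcomm /lnorm -cats1 foldl_cat.
(* A bracket of two commutators is 0 in both algebras; the coefficient 0 records this, and the
   indices are arbitrary. *)
- exists 0, 0, 0, [::]; rewrite !scale0r; split.
    rewrite commutatorZl commutatorC commutatorZl commutator_ecomm2.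
    by rewrite scaler0 oppr0 scaler0.
  rewrite linearZr_LR linearZl_LR /= /lcomm.
  have [u1 [u2 ->]] := lnorm_br (x a) (x b) s.
  by have [v1 [v2 ->]] := lnorm_br (x a') (x b') t; rewrite brM !scaler0.
Qed.

Lemma Phi_eval_word w :
  Phi (eval_word (commutator mul) (e^~ [::]) w) = eval_word br x w.
Proof.
case: (eval_word_commutator w) => [[i ->]|[c [a [b [s [-> ->]]]]]].
  by rewrite /= Phi_e.
by rewrite linearZ /= Phi_ecomm.
Qed.

Lemma Phi_eval_napoly f :
  Phi (eval_napoly (commutator mul) (e^~ [::]) f) = eval_napoly br x f.
Proof.
rewrite /eval_napoly linear_sum; apply: eq_bigr => w _.
by rewrite linearZ /= Phi_eval_word.
Qed.

End Intertwining.

End MetabelianLie.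

(* A K-algebra is a K-module with a bilinear product, neither associative nor
   unital in general. *)
Theorem theorem2p1 (K : fieldType) (charK0 : [pchar K] =i pred0)
    (f : napoly K) :
  (forall (A : lmodType K) (mul : {bilinear A -> A -> A}),
     bicommutative mul -> satisfies_identity (commutator mul) f) ->
  forall (L : lmodType K) (br : {bilinear L -> L -> L}),
    anticommutative br -> jacobi br -> metabelian br ->
    satisfies_identity br f.
Proof.
move=> bicomm_f L br brC brJ brM x.
pose Phi := malg_lift (Phi_basis br x) : {linear walg K -> L}.
have Phi_wbasis i s : Phi (wbasis K i s) = Phi_basis br x (i, s).
  (* [wbasis] sorts its sequence, so [Phi_basis] must not depend on the order of the letters. *)
  by rewrite /Phi /= /wbasis malg_liftU; apply: Phi_basis_perm; rewrite ?perm_sort.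
rewrite -(Phi_eval_napoly charK0 brC brJ brM (@wbasis_perm K) (@wmul_wbasis K)
            Phi_wbasis f).
by rewrite (bicomm_f _ _ (@wmul_bicommutative K)) linear0.
Qed.
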